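(* Let $\mathcal{B}$ be a binary relation on abstract local configurations, $\mathcal{R}$ a relation between abstract and concrete local configurations, $\mathcal{I}$ a binary relation on concrete local configurations, and $\mathit{abs\text{-}steps}$ a function assigning a natural number to each pair (abstract configuration, concrete configuration). If $\mathsf{secure\text{-}refinement\text{-}decomp}\ \mathcal{B}\ \mathcal{R}\ \mathcal{I}\ \mathit{abs\text{-}steps}$ holds, then $\mathsf{secure\text{-}refinement}\ \mathcal{B}\ \mathcal{R}\ \mathcal{I}$ holds.
   Context: Setting. Fix a type $\mathit{Val}$ of values and a finite set $\mathit{Var}$ of shared variables. Let $\mathit{Mode}=\{\mathbf{AsmNoW},\mathbf{AsmNoRW},\mathbf{GuarNoW},\mathbf{GuarNoRW}\}$. A mode state is a function $\mathit{mds}:\mathit{Mode}\to\mathcal{P}(\mathit{Var})$; a memory is a total function $\mathit{mem}:\mathit{Var}\to\mathit{Val}$. An abstract local configuration is a triple $\langle \mathit{tps},\mathit{mds},\mathit{mem}\rangle$ with $\mathit{tps}$ of some arbitrary type $T_A$ (thread-private state); a concrete local configuration is such a triple with $\mathit{tps}$ of some arbitrary type $T_C$. There is an abstract step relation $\rightsquigarrow_A$ on abstract configurations and a concrete step relation $\rightsquigarrow_C$ on concrete configurations, both deterministic (each configuration has at most one successor). $\rightsquigarrow_A^{n}$ denotes $n$-fold composition of $\rightsquigarrow_A$ ($n=0$ is identity). $\mathsf{stops}\ \mathit{lc}$ means there is no $\mathit{lc}'$ with $\mathit{lc}\rightsquigarrow_C \mathit{lc}'$. Fix a classification function $\mathcal{L}:(\mathit{Var}\to\mathit{Val})\to\mathit{Var}\to\{\mathrm{High},\mathrm{Low}\}$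 and a function $\mathcal{C}\mathsf{vars}:\mathit{Var}\to\mathcal{P}(\mathit{Var})$; let $\mathcal{C}=\{y\mid \exists x.\ y\in\mathcal{C}\mathsf{vars}\ x\}$. Define $\mathsf{readable}\ \mathit{mds}\ x \equiv x\notin \mathit{mds}\ \mathbf{AsmNoRW}$ and $\mathsf{writable}\ \mathit{mds}\ x\equiv x\notin\mathit{mds}\ \mathbf{AsmNoW}\wedge x\notin\mathit{mds}\ \mathbf{AsmNoRW}$. Memories are low-equivalent modulo $\mathit{mds}$, written $\mathit{mem}_1 =^{\mathrm{Low}}_{\mathit{mds}} \mathit{mem}_2$, iff for all $x$: if $x\in\mathcal{C}$ or ($\mathcal{L}\ \mathit{mem}_1\ x=\mathrm{Low}$ and $\mathsf{readable}\ \mathit{mds}\ x$) then $\mathit{mem}_1\ x=\mathit{mem}_2\ x$. For configurations (abstract or concrete), $\mathit{lc}_1 \sim_{\mathit{mds}} \mathit{lc}_2$ means they have equal mode states, and $\mathit{lc}_1\sim^{\mathit{mem}}_{\mathit{mds}}\mathit{lc}_2$ means they have equal mode states and equal memories. Definitions. - $\mathsf{preserves\text{-}modes\text{-}mem}\ \mathcal{R}$: for all $(\mathit{lc}_A,\mathit{lc}_C)\in\mathcal{R}$, $\mathit{lc}_A\sim^{\mathit{mem}}_{\mathit{mds}}\mathit{lc}_C$. - $\mathsf{closed\text{-}others}\ \mathcal{R}$: for all $\mathit{tps}_A,\mathit{tps}_C,\mathit{mds},\mathit{mem},\mathit{mem}'$: if $(\langle\mathit{tps}_A,\mathit{mds},\mathit{mem}\rangle,\langle\mathit{tps}_C,\mathit{mds},\mathit{mem}\rangle)\in\mathcal{R}$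 and for every $x$ with $\mathit{mem}\ x\ne\mathit{mem}'\ x$ or $\mathcal{L}\ \mathit{mem}\ x\neq\mathcal{L}\ \mathit{mem}'\ x$ we have $\mathsf{writable}\ \mathit{mds}\ x$, then $(\langle\mathit{tps}_A,\mathit{mds},\mathit{mem}'\rangle,\langle\mathit{tps}_C,\mathit{mds},\mathit{mem}'\rangle)\in\mathcal{R}$. - $\mathsf{cg\text{-}consistent}\ \mathcal{I}$: for all $\mathit{tps}_1,\mathit{mem}_1,\mathit{tps}_2,\mathit{mem}_2,\mathit{mds}$ with $(\langle\mathit{tps}_1,\mathit{mds},\mathit{mem}_1\rangle,\langle\mathit{tps}_2,\mathit{mds},\mathit{mem}_2\rangle)\in\mathcal{I}$, and all $\mathit{mem}_1',\mathit{mem}_2'$: if for every $x$ with $\mathit{mem}_1\ x\ne\mathit{mem}_1'\ x$ or $\mathit{mem}_2\ x\neq\mathit{mem}_2'\ x$ or $\mathcal{L}\ \mathit{mem}_1\ x\ne\mathcal{L}\ \mathit{mem}_1'\ x$ we have $\mathsf{writable}\ \mathit{mds}\ x$, and $\mathit{mem}_1' =^{\mathrm{Low}}_{\mathit{mds}}\mathit{mem}_2'$, then $(\langle\mathit{tps}_1,\mathit{mds},\mathit{mem}_1'\rangle,\langle\mathit{tps}_2,\mathit{mds},\mathit{mem}_2'\rangle)\in\mathcal{I}$. - $\mathsf{sym}\ \mathcal{I}$: $\mathcal{I}$ is symmetric. - $\mathsf{coupling\text{-}inv\text{-}pres}\ \mathcal{B}\ \mathcal{R}\ \mathcal{I}$: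 for all $(\mathit{lc}_{1A},\mathit{lc}_{1C})\in\mathcal{R}$ and all $\mathit{lc}_{1C}'$ with $\mathit{lc}_{1C}\rightsquigarrow_C\mathit{lc}_{1C}'$, there exist $n$ and $\mathit{lc}_{1A}'$ with $\mathit{lc}_{1A}\rightsquigarrow_A^{n}\mathit{lc}_{1A}'$, $(\mathit{lc}_{1A}',\mathit{lc}_{1C}')\in\mathcal{R}$, and such that for all $\mathit{lc}_{2A},\mathit{lc}_{2C},\mathit{lc}_{2A}'$: if $(\mathit{lc}_{1A},\mathit{lc}_{2A})\in\mathcal{B}$, $\mathit{lc}_{1A}\sim_{\mathit{mds}}\mathit{lc}_{2A}$, $(\mathit{lc}_{2A},\mathit{lc}_{2C})\in\mathcal{R}$, $(\mathit{lc}_{1C},\mathit{lc}_{2C})\in\mathcal{I}$, $\mathit{lc}_{1C}\sim_{\mathit{mds}}\mathit{lc}_{2C}$, $\mathit{lc}_{2A}\rightsquigarrow_A^{n}\mathit{lc}_{2A}'$ and $\mathit{lc}_{1A}'\sim_{\mathit{mds}}\mathit{lc}_{2A}'$, then there exists $\mathit{lc}_{2C}'$ with $\mathit{lc}_{2C}\rightsquigarrow_C\mathit{lc}_{2C}'$, $\mathit{lc}_{1C}'\sim_{\mathit{mds}}\mathit{lc}_{2C}'$, $(\mathit{lc}_{2A}',\mathit{lc}_{2C}')\in\mathcal{R}$ and $(\mathit{lc}_{1C}',\mathit{lc}_{2C}')\in\mathcal{I}$. - $\mathsf{secure\text{-}refinement}\ \mathcal{B}\ \mathcal{R}\ \mathcal{I}\equiv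 \mathsf{preserves\text{-}modes\text{-}mem}\ \mathcal{R}\wedge\mathsf{closed\text{-}others}\ \mathcal{R}\wedge\mathsf{cg\text{-}consistent}\ \mathcal{I}\wedge\mathsf{sym}\ \mathcal{I}\wedge\mathsf{coupling\text{-}inv\text{-}pres}\ \mathcal{B}\ \mathcal{R}\ \mathcal{I}$. - $\mathsf{decomp\text{-}refinement\text{-}safe}\ \mathcal{B}\ \mathcal{R}\ \mathcal{I}\ \mathit{abs\text{-}steps}$: for all $\mathit{lc}_{1A},\mathit{lc}_{2A},\mathit{lc}_{1C},\mathit{lc}_{2C}$ with $(\mathit{lc}_{1A},\mathit{lc}_{2A})\in\mathcal{B}$, $\mathit{lc}_{1A}\sim_{\mathit{mds}}\mathit{lc}_{2A}$, $(\mathit{lc}_{1A},\mathit{lc}_{1C})\in\mathcal{R}$, $(\mathit{lc}_{2A},\mathit{lc}_{2C})\in\mathcal{R}$, $(\mathit{lc}_{1C},\mathit{lc}_{2C})\in\mathcal{I}$ and $\mathit{lc}_{1C}\sim_{\mathit{mds}}\mathit{lc}_{2C}$: (i) $\mathsf{stops}\ \mathit{lc}_{1C}\iff\mathsf{stops}\ \mathit{lc}_{2C}$; (ii) $\mathit{abs\text{-}steps}\ \mathit{lc}_{1A}\ \mathit{lc}_{1C}=\mathit{abs\text{-}steps}\ \mathit{lc}_{2A}\ \mathit{lc}_{2C}$; (iii) for all $\mathit{lc}_{1C}',\mathit{lc}_{2C}'$ with $\mathit{lc}_{1C}\rightsquigarrow_C\mathit{lc}_{1C}'$ and $\mathit{lc}_{2C}\rightsquigarrow_C\mathit{lc}_{2C}'$,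 we have $(\mathit{lc}_{1C}',\mathit{lc}_{2C}')\in\mathcal{I}$ and $\mathit{lc}_{1C}'\sim_{\mathit{mds}}\mathit{lc}_{2C}'$. - $\mathsf{secure\text{-}refinement\text{-}decomp}\ \mathcal{B}\ \mathcal{R}\ \mathcal{I}\ \mathit{abs\text{-}steps}\equiv \mathsf{preserves\text{-}modes\text{-}mem}\ \mathcal{R}\wedge\mathsf{closed\text{-}others}\ \mathcal{R}\wedge\mathsf{cg\text{-}consistent}\ \mathcal{I}\wedge\mathsf{sym}\ \mathcal{I}\wedge\mathsf{decomp\text{-}refinement\text{-}safe}\ \mathcal{B}\ \mathcal{R}\ \mathcal{I}\ \mathit{abs\text{-}steps}\ \wedge$ (for all $(\mathit{lc}_A,\mathit{lc}_C)\in\mathcal{R}$ and all $\mathit{lc}_C'$ with $\mathit{lc}_C\rightsquigarrow_C\mathit{lc}_C'$, there exists $\mathit{lc}_A'$ with $\mathit{lc}_A\rightsquigarrow_A^{\mathit{abs\text{-}steps}\ \mathit{lc}_A\ \mathit{lc}_C}\mathit{lc}_A'$ and $(\mathit{lc}_A',\mathit{lc}_C')\in\mathcal{R}$). *)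

(* Defs.v *)
From mathcomp Require Import all_boot.
From Corelib Require RelationClasses.

Set Implicit Arguments.
Unset Strict Implicit.
Unset Printing Implicit Defensive.

Inductive mode := AsmNoW | AsmNoRW | GuarNoW | GuarNoRW.

Inductive level := High | Low.

Definition mode_state (Var : finType) := mode -> {set Var}.

Definition memory (Val : Type) (Var : finType) := Var -> Val.

Record lconf (Val : Type) (Var : finType) (T : Type) := LConf {
  tps : T;
  mds : mode_state Var;
  mem : memory Val Var
}.

Definition same_mds (Val : Type) (Var : finType) (T T' : Type)
    (lc : lconf Val Var T) (lc' : lconf Val Var T') : Prop :=
  mds lc = mds lc'.

Definition same_mds_mem (Val : Type) (Var : finType) (T T' : Type)
    (lc : lconf Val Var T) (lc' : lconf Val Var T') : Prop :=
  mds lc = mds lc' /\ mem lc = mem lc'.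

Definition deterministic (S : Type) (step : S -> S -> Prop) : Prop :=
  forall s s1 s2, step s s1 -> step s s2 -> s1 = s2.

Fixpoint nsteps (S : Type) (step : S -> S -> Prop) (n : nat) (s s' : S) : Prop :=
  if n is n'.+1 then exists t, step s t /\ nsteps step n' t s' else s = s'.

Definition stops (S : Type) (step : S -> S -> Prop) (s : S) : Prop :=
  ~ exists s', step s s'.

Definition readable (Var : finType) (m : mode_state Var) (x : Var) : bool :=
  x \notin m AsmNoRW.

Definition writable (Var : finType) (m : mode_state Var) (x : Var) : bool :=
  (x \notin m AsmNoW) && (x \notin m AsmNoRW).

Definition control_vars (Var : finType) (Cvars : Var -> {set Var}) : {set Var} :=
  [set y | [exists x, y \in Cvars x]].

Definition low_eq (Val : Type) (Var : finType)
    (L : memory Val Var -> Var -> level) (Cvars : Var -> {set Var})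
    (m : mode_state Var) (mem1 mem2 : memory Val Var) : Prop :=
  forall x, x \in control_vars Cvars \/ (L mem1 x = Low /\ readable m x) ->
    mem1 x = mem2 x.

Definition preserves_modes_mem (Val : Type) (Var : finType) (TA TC : Type)
    (R : lconf Val Var TA -> lconf Val Var TC -> Prop) : Prop :=
  forall lcA lcC, R lcA lcC -> same_mds_mem lcA lcC.

Definition closed_others (Val : Type) (Var : finType) (TA TC : Type)
    (L : memory Val Var -> Var -> level)
    (R : lconf Val Var TA -> lconf Val Var TC -> Prop) : Prop :=
  forall (tA : TA) (tC : TC) (m : mode_state Var) (mem mem' : memory Val Var),
    R (LConf tA m mem) (LConf tC m mem) ->
    (forall x, mem x <> mem' x \/ L mem x <> L mem' x -> writable m x) ->
    R (LConf tA m mem') (LConf tC m mem').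

(* The hypothesis on changed variables mentions the classification in the first
   memory only: this asymmetry is intended. *)
Definition cg_consistent (Val : Type) (Var : finType) (T : Type)
    (L : memory Val Var -> Var -> level) (Cvars : Var -> {set Var})
    (I : lconf Val Var T -> lconf Val Var T -> Prop) : Prop :=
  forall (t1 : T) (mem1 : memory Val Var) (t2 : T) (mem2 : memory Val Var)
         (m : mode_state Var),
    I (LConf t1 m mem1) (LConf t2 m mem2) ->
    forall mem1' mem2' : memory Val Var,
      (forall x, mem1 x <> mem1' x \/ mem2 x <> mem2' x \/ L mem1 x <> L mem1' x ->
         writable m x) ->
      low_eq L Cvars m mem1' mem2' ->
      I (LConf t1 m mem1') (LConf t2 m mem2').

Definition coupling_inv_pres (Val : Type) (Var : finType) (TA TC : Type)
    (stepA : lconf Val Var TA -> lconf Val Var TA -> Prop)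
    (stepC : lconf Val Var TC -> lconf Val Var TC -> Prop)
    (B : lconf Val Var TA -> lconf Val Var TA -> Prop)
    (R : lconf Val Var TA -> lconf Val Var TC -> Prop)
    (I : lconf Val Var TC -> lconf Val Var TC -> Prop) : Prop :=
  forall lc1A lc1C, R lc1A lc1C ->
  forall lc1C', stepC lc1C lc1C' ->
  exists (n : nat) (lc1A' : lconf Val Var TA),
    [/\ nsteps stepA n lc1A lc1A',
        R lc1A' lc1C' &
        forall lc2A lc2C lc2A',
          B lc1A lc2A -> same_mds lc1A lc2A ->
          R lc2A lc2C ->
          I lc1C lc2C -> same_mds lc1C lc2C ->
          nsteps stepA n lc2A lc2A' -> same_mds lc1A' lc2A' ->
          exists lc2C', [/\ stepC lc2C lc2C', same_mds lc1C' lc2C',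
                            R lc2A' lc2C' & I lc1C' lc2C']].

Definition secure_refinement (Val : Type) (Var : finType) (TA TC : Type)
    (L : memory Val Var -> Var -> level) (Cvars : Var -> {set Var})
    (stepA : lconf Val Var TA -> lconf Val Var TA -> Prop)
    (stepC : lconf Val Var TC -> lconf Val Var TC -> Prop)
    (B : lconf Val Var TA -> lconf Val Var TA -> Prop)
    (R : lconf Val Var TA -> lconf Val Var TC -> Prop)
    (I : lconf Val Var TC -> lconf Val Var TC -> Prop) : Prop :=
  [/\ preserves_modes_mem R,
      closed_others L R,
      cg_consistent L Cvars I,
      RelationClasses.Symmetric I &
      coupling_inv_pres stepA stepC B R I].

Definition decomp_refinement_safe (Val : Type) (Var : finType) (TA TC : Type)
    (stepC : lconf Val Var TC -> lconf Val Var TC -> Prop)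
    (B : lconf Val Var TA -> lconf Val Var TA -> Prop)
    (R : lconf Val Var TA -> lconf Val Var TC -> Prop)
    (I : lconf Val Var TC -> lconf Val Var TC -> Prop)
    (abs_steps : lconf Val Var TA -> lconf Val Var TC -> nat) : Prop :=
  forall lc1A lc2A lc1C lc2C,
    B lc1A lc2A -> same_mds lc1A lc2A ->
    R lc1A lc1C -> R lc2A lc2C ->
    I lc1C lc2C -> same_mds lc1C lc2C ->
    [/\ stops stepC lc1C <-> stops stepC lc2C,
        abs_steps lc1A lc1C = abs_steps lc2A lc2C &
        forall lc1C' lc2C', stepC lc1C lc1C' -> stepC lc2C lc2C' ->
          I lc1C' lc2C' /\ same_mds lc1C' lc2C'].

Definition secure_refinement_decomp (Val : Type) (Var : finType) (TA TC : Type)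
    (L : memory Val Var -> Var -> level) (Cvars : Var -> {set Var})
    (stepA : lconf Val Var TA -> lconf Val Var TA -> Prop)
    (stepC : lconf Val Var TC -> lconf Val Var TC -> Prop)
    (B : lconf Val Var TA -> lconf Val Var TA -> Prop)
    (R : lconf Val Var TA -> lconf Val Var TC -> Prop)
    (I : lconf Val Var TC -> lconf Val Var TC -> Prop)
    (abs_steps : lconf Val Var TA -> lconf Val Var TC -> nat) : Prop :=
  preserves_modes_mem R /\
  closed_others L R /\
  cg_consistent L Cvars I /\
  RelationClasses.Symmetric I /\
  decomp_refinement_safe stepC B R I abs_steps /\
  (forall lcA lcC, R lcA lcC ->
   forall lcC', stepC lcC lcC' ->
   exists lcA', nsteps stepA (abs_steps lcA lcC) lcA lcA' /\ R lcA' lcC').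

(* Main.v *)
Require Import Defs.
From mathcomp Require Import all_boot.
From Stdlib Require Import Classical_Prop.

Set Implicit Arguments.
Unset Strict Implicit.
Unset Printing Implicit Defensive.

(* Two related pairs of configurations take the same number of abstract steps,
   and this number depends only on the configurations before the step.  Since
   the abstract system is deterministic, the given abstract run of the second
   pair therefore ends in the very state that simulates its concrete step.
   That the second concrete configuration can step at all follows, classically,
   from the agreement on stopping. *)

Section TransitionSystem.
Variables (State : Type) (step : State -> State -> Prop).

Lemma nsteps_deterministic (n : nat) :
  deterministic step -> deterministic (nsteps step n).
Proof.
move=> det; elim: n => [|n IHn] s s1 s2 /=; first by move=> <- <-.
move=> [t1 [step1 run1]] [t2 [step2 run2]].
by apply: IHn run1 _; rewrite (det _ _ _ step1 step2).
Qed.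

Lemma not_stopsP (s : State) : ~ stops step s <-> exists s', step s s'.
Proof. by split=> [/NNPP | can_step]; last apply. Qed.

End TransitionSystem.

Section PacedSimulation.
Variables (StateA StateC : Type).
Variables (stepA : StateA -> StateA -> Prop) (stepC : StateC -> StateC -> Prop).
Variables (R : StateA -> StateC -> Prop) (pace : StateA -> StateC -> nat).

Definition paced_simulation : Prop :=
  forall sA sC, R sA sC -> forall sC', stepC sC sC' ->
  exists sA', nsteps stepA (pace sA sC) sA sA' /\ R sA' sC'.

Lemma paced_simulation_nsteps sA sA' sC sC' :
    deterministic stepA -> paced_simulation -> R sA sC -> stepC sC sC' ->
  nsteps stepA (pace sA sC) sA sA' -> R sA' sC'.
Proof.
move=> detA sim RAC step_C run.
have [tA [run_t RtA]] := sim _ _ RAC _ step_C.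
by rewrite (nsteps_deterministic detA run run_t).
Qed.

End PacedSimulation.

Section DecompositionPrinciple.
Variables (Val : Type) (Var : finType) (TA TC : Type).
Variables (stepA : lconf Val Var TA -> lconf Val Var TA -> Prop)
          (stepC : lconf Val Var TC -> lconf Val Var TC -> Prop).
Variables (B : lconf Val Var TA -> lconf Val Var TA -> Prop)
          (R : lconf Val Var TA -> lconf Val Var TC -> Prop)
          (I : lconf Val Var TC -> lconf Val Var TC -> Prop)
          (abs_steps : lconf Val Var TA -> lconf Val Var TC -> nat).
Hypothesis safe : decomp_refinement_safe stepC B R I abs_steps.

Lemma decomp_refinement_safe_step lc1A lc2A lc1C lc2C lc1C' :
    B lc1A lc2A -> same_mds lc1A lc2A -> R lc1A lc1C -> R lc2A lc2C ->
    I lc1C lc2C -> same_mds lc1C lc2C -> stepC lc1C lc1C' ->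
  exists lc2C', [/\ stepC lc2C lc2C', same_mds lc1C' lc2C' & I lc1C' lc2C'].
Proof.
move=> B12 mdsA R1 R2 I12 mdsC step1.
have [stops12 _ next] := safe B12 mdsA R1 R2 I12 mdsC.
have [lc2C' step2] : exists lc2C', stepC lc2C lc2C'.
  by apply/not_stopsP => /stops12; apply/not_stopsP; exists lc1C'.
by exists lc2C'; have [I12' mdsC'] := next _ _ step1 step2.
Qed.

Lemma decomp_coupling_inv_pres :
    deterministic stepA -> paced_simulation stepA stepC R abs_steps ->
  coupling_inv_pres stepA stepC B R I.
Proof.
move=> detA sim lc1A lc1C R1 lc1C' step1.
have [lc1A' [run1 R1']] := sim _ _ R1 _ step1.
exists (abs_steps lc1A lc1C), lc1A'; split=> //.
move=> lc2A lc2C lc2A' B12 mdsA R2 I12 mdsC run2 _.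
have [lc2C' [step2 mdsC' I12']] :=
  decomp_refinement_safe_step B12 mdsA R1 R2 I12 mdsC step1.
exists lc2C'; split=> //.
apply: (paced_simulation_nsteps detA sim R2 step2).
by have [_ <- _] := safe B12 mdsA R1 R2 I12 mdsC.
Qed.

End DecompositionPrinciple.

Theorem theorem9 (Val : Type) (Var : finType) (TA TC : Type)
    (L : memory Val Var -> Var -> level) (Cvars : Var -> {set Var})
    (stepA : lconf Val Var TA -> lconf Val Var TA -> Prop)
    (stepC : lconf Val Var TC -> lconf Val Var TC -> Prop)
    (detA : deterministic stepA) (detC : deterministic stepC)
    (B : lconf Val Var TA -> lconf Val Var TA -> Prop)
    (R : lconf Val Var TA -> lconf Val Var TC -> Prop)
    (I : lconf Val Var TC -> lconf Val Var TC -> Prop)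
    (abs_steps : lconf Val Var TA -> lconf Val Var TC -> nat) :
  secure_refinement_decomp L Cvars stepA stepC B R I abs_steps ->
  secure_refinement L Cvars stepA stepC B R I.
Proof.
move=> [presR [closR [consI [symI [safe sim]]]]]; split=> //.
exact: decomp_coupling_inv_pres safe detA sim.
Qed.
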